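(* The category $\mathsf{ELHSLat}$ of equationally linear Heyting semilattices is algebraically coherent.
   Context: A Heyting semilattice $(H,1,\wedge,\to)$ is a meet-semilattice with top element $1$ and a binary operation $\to$ such that $x\wedge y\leq z$ if and only if $x\leq y\to z$ (equivalently, a cartesian closed poset). Morphisms preserve $1$, $\wedge$ and $\to$. A Heyting semilattice is equationally linear when it satisfies $((x\to y)\to z)\wedge((y\to x)\to z)=z$. $\mathsf{ELHSLat}$ is the variety (category) of equationally linear Heyting semilattices and their morphisms. For an object $B$ of a category $\mathcal{C}$ with finite limits, $\mathsf{Pt}_B(\mathcal{C})$ is the category of points over $B$: objects are triples $(A,\alpha\colon A\to B,\beta\colon B\to A)$ with $\alpha\beta=1_B$; morphisms are morphisms between the objects $A$ commuting with the given split epimorphisms and sections. For $p\colon E\to B$, the change-of-base functor $p^*\colon\mathsf{Pt}_B(\mathcal{C})\to\mathsf{Pt}_E(\mathcal{C})$ sends $(A,\alpha,\beta)$ to the pullback of $\alpha$ along $p$ with the induced section. A category $\mathcal{C}$ with finite limits is algebraically coherent when, for each morphism $p\colon E\to B$ in $\mathcal{C}$, the functor $p^*$ is coherent, i.e. it preserves finite limits and jointly strongly epimorphic pairs of morphisms (a pair of morphisms with the same codomain is jointly strongly epimorphic when, whenever both factor through a monomorphism $m$, $m$ is an isomorphism). *)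

(* Defs.v *)
From Stdlib Require Import List FunctionalExtensionality ProofIrrelevance ClassicalEpsilon.

Set Implicit Arguments.
Unset Strict Implicit.
Unset Printing Implicit Defensive.

Record category := Category {
  ob :> Type;
  hom : ob -> ob -> Type;
  idm : forall a : ob, hom a a;
  comp : forall a b c : ob, hom b c -> hom a b -> hom a c;
  comp_idl : forall (a b : ob) (f : hom a b), comp (idm b) f = f;
  comp_idr : forall (a b : ob) (f : hom a b), comp f (idm a) = f;
  comp_assoc : forall (a b c d : ob) (h : hom c d) (g : hom b c) (f : hom a b),
    comp h (comp g f) = comp (comp h g) f }.

Arguments hom {C} a b : rename.
Arguments idm {C} a : rename.
Arguments comp {C a b c} g f : rename.

Declare Scope cat_scope.
Delimit Scope cat_scope with cat.
Local Open Scope cat_scope.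
Notation "g ∘ f" := (comp g f) (at level 40, left associativity) : cat_scope.

Definition is_mono (C : category) (a b : C) (m : hom a b) : Prop :=
  forall (x : C) (f g : hom x a), m ∘ f = m ∘ g -> f = g.

Definition is_iso (C : category) (a b : C) (f : hom a b) : Prop :=
  exists g : hom b a, g ∘ f = idm a /\ f ∘ g = idm b.

Definition factors_through (C : category) (a b c : C)
    (f : hom a c) (m : hom b c) : Prop :=
  exists f' : hom a b, m ∘ f' = f.

Definition jointly_strongly_epi (C : category) (a b c : C)
    (f : hom a c) (g : hom b c) : Prop :=
  forall (d : C) (m : hom d c), is_mono m ->
    factors_through f m -> factors_through g m -> is_iso m.

Record functor (C D : category) := Functor {
  fob :> C -> D;
  fhom : forall a b : C, hom a b -> hom (fob a) (fob b);
  fhom_id : forall a : C, fhom (idm a) = idm (fob a);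
  fhom_comp : forall (a b c : C) (g : hom b c) (f : hom a b),
    fhom (g ∘ f) = fhom g ∘ fhom f }.

Arguments fhom {C D} F {a b} f : rename.

Definition functor_comp (A B C : category) (G : functor B C) (F : functor A B) :
  functor A C.
Proof.
  refine (@Functor A C (fun a => G (F a)) (fun a b f => fhom G (fhom F f)) _ _).
  - intros a. rewrite !fhom_id. reflexivity.
  - intros a b c g f. rewrite !fhom_comp. reflexivity.
Defined.

Record cone (J C : category) (D : functor J C) := Cone {
  apex : C;
  leg : forall j : J, hom apex (D j);
  leg_natural : forall (i j : J) (u : hom i j), fhom D u ∘ leg i = leg j }.

Arguments apex {J C D} K : rename.
Arguments leg {J C D} K j : rename.

Definition is_limit (J C : category) (D : functor J C) (K : cone D) : Prop :=
  forall K' : cone D,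
    exists! h : hom (apex K') (apex K), forall j : J, leg K j ∘ h = leg K' j.

Definition map_cone (J C C' : category) (D : functor J C) (F : functor C C')
    (K : cone D) : cone (functor_comp F D).
Proof.
  refine (@Cone J C' (functor_comp F D) (F (apex K)) (fun j => fhom F (leg K j)) _).
  intros i j u. cbn. rewrite <- fhom_comp, leg_natural. reflexivity.
Defined.

Definition finite_type (T : Type) : Prop :=
  exists s : list T, forall x : T, In x s.

Definition finite_category (J : category) : Prop :=
  finite_type J /\ forall i j : J, finite_type (hom i j).

Definition has_finite_limits (C : category) : Prop :=
  forall (J : category) (D : functor J C), finite_category J ->
    exists K : cone D, is_limit K.

Definition preserves_finite_limits (C C' : category) (F : functor C C') : Prop :=
  forall (J : category) (D : functor J C) (K : cone D), finite_category J ->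
    is_limit K -> is_limit (map_cone F K).

Definition preserves_jointly_strongly_epi (C C' : category) (F : functor C C') :
    Prop :=
  forall (a b c : C) (f : hom a c) (g : hom b c),
    jointly_strongly_epi f g -> jointly_strongly_epi (fhom F f) (fhom F g).

Definition coherent_functor (C C' : category) (F : functor C C') : Prop :=
  preserves_finite_limits F /\ preserves_jointly_strongly_epi F.

Record pullback (C : category) (a e b : C) (f : hom a b) (p : hom e b) := Pullback {
  pb_ob : C;
  pb_fst : hom pb_ob a;
  pb_snd : hom pb_ob e;
  pb_comm : f ∘ pb_fst = p ∘ pb_snd;
  pb_pair : forall (x : C) (u : hom x a) (v : hom x e),
    f ∘ u = p ∘ v -> hom x pb_ob;
  pb_fst_pair : forall (x : C) (u : hom x a) (v : hom x e) (H : f ∘ u = p ∘ v),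
    pb_fst ∘ pb_pair H = u;
  pb_snd_pair : forall (x : C) (u : hom x a) (v : hom x e) (H : f ∘ u = p ∘ v),
    pb_snd ∘ pb_pair H = v;
  pb_unique : forall (x : C) (h k : hom x pb_ob),
    pb_fst ∘ h = pb_fst ∘ k -> pb_snd ∘ h = pb_snd ∘ k -> h = k }.

Definition pullback_choice (C : category) : Type :=
  forall (a e b : C) (f : hom a b) (p : hom e b), pullback f p.

(** Finite limits provide a choice of pullbacks, so that quantifying over all
    such choices in [algebraically_coherent] below is never vacuous. *)

Definition cospan_le (i j : option bool) : Prop :=
  i = j \/ (i <> None /\ j = None).

Lemma cospan_le_trans (i j k : option bool) :
  cospan_le j k -> cospan_le i j -> cospan_le i k.
Proof. intros [<- | [Hj ->]] [<- | [Hi ->]]; unfold cospan_le; auto. Qed.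

Definition cospan_category : category.
Proof.
  refine (@Category (option bool) cospan_le (fun i => or_introl eq_refl)
    cospan_le_trans _ _ _); intros; apply proof_irrelevance.
Defined.

Lemma cospan_finite : finite_category cospan_category.
Proof.
  split.
  - exists (None :: Some true :: Some false :: nil).
    intros [[|]|]; cbn; auto.
  - intros i j.
    destruct (classic (cospan_le i j)) as [h | n].
    + exists (h :: nil). intros x. left. exact (proof_irrelevance (cospan_le i j) h x).
    + exists nil. intros x. exact (n x).
Qed.

Section Cospan.
Variables (C : category) (a e b : C) (f : hom a b) (p : hom e b).

Definition cospan_ob (i : option bool) : C :=
  match i with Some true => a | Some false => e | None => b end.

Definition cospan_to_base (i : option bool) : hom (cospan_ob i) b :=
  match i with Some true => f | Some false => p | None => idm b end.

Definition cospan_hom (i j : option bool) (u : cospan_le i j) : hom (cospan_ob i) (cospan_ob j).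
Proof.
  destruct (excluded_middle_informative (i = j)) as [<- | ne].
  - exact (idm _).
  - assert (H : None = j) by (destruct u as [|[_ ->]]; [contradiction | reflexivity]).
    destruct H. exact (cospan_to_base i).
Defined.

Lemma cospan_hom_irr i j (u v : cospan_le i j) : cospan_hom u = cospan_hom v.
Proof. f_equal. apply proof_irrelevance. Qed.

Lemma cospan_hom_refl i u : @cospan_hom i i u = idm _.
Proof.
  unfold cospan_hom. destruct excluded_middle_informative as [q | n].
  - rewrite (proof_irrelevance _ q eq_refl). reflexivity.
  - contradiction.
Qed.

Lemma cospan_hom_base i u : @cospan_hom i None u = cospan_to_base i.
Proof.
  destruct i as [i|]; [| apply cospan_hom_refl].
  unfold cospan_hom. destruct excluded_middle_informative as [q | n].
  - discriminate q.
  - match goal with |- context [match ?H with eq_refl => _ end] =>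
      rewrite (proof_irrelevance _ H eq_refl) end. reflexivity.
Qed.

Definition cospan : functor cospan_category C.
Proof.
  refine (@Functor cospan_category C cospan_ob cospan_hom _ _).
  - intros i. apply cospan_hom_refl.
  - intros i j k v u.
    assert (Hjk := v). assert (Hij := u).
    destruct Hjk as [<- | [_ ->]].
    + rewrite (cospan_hom_refl v), comp_idl. apply cospan_hom_irr.
    + destruct Hij as [<- | [_ ->]].
      * rewrite (cospan_hom_refl u), comp_idr. apply cospan_hom_irr.
      * rewrite (cospan_hom_refl v), comp_idl. apply cospan_hom_irr.
Defined.

Definition cospan_cone (x : C) (u : hom x a) (v : hom x e) (H : f ∘ u = p ∘ v) :
  cone cospan.
Proof.
  refine (@Cone _ _ cospan x
    (fun i => match i return hom x (cospan_ob i) with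
              | Some true => u | Some false => v | None => f ∘ u end) _).
  intros i j w. cbn. assert (Hw := w). destruct Hw as [<- | [n ->]].
  - rewrite (cospan_hom_refl w). apply comp_idl.
  - rewrite (cospan_hom_base w). destruct i as [[|]|]; cbn; congruence.
Defined.

Lemma cospan_limit_pullback (K : cone cospan) :
  is_limit K -> inhabited (pullback f p).
Proof.
  intros lim.
  assert (base : forall i : option bool,
             cospan_to_base i ∘ leg K i = leg K (None : cospan_category)).
  { intros [i|]; [| apply comp_idl].
    assert (u : @hom cospan_category (Some i) None)
      by (right; split; [discriminate | reflexivity]).
    rewrite <- (leg_natural K u). cbn. rewrite cospan_hom_base. reflexivity. }
  assert (comm : f ∘ leg K (Some true : cospan_category)
                 = p ∘ leg K (Some false : cospan_category))
    by exact (eq_trans (base (Some true)) (eq_sym (base (Some false)))).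
  pose (med := fun x (u : hom x a) (v : hom x e) (H : f ∘ u = p ∘ v) =>
    constructive_indefinite_description _ (lim (cospan_cone H))).
  constructor.
  refine (@Pullback C a e b f p (apex K) (leg K (Some true : cospan_category))
    (leg K (Some false : cospan_category)) comm
    (fun x u v H => proj1_sig (med x u v H)) _ _ _).
  - intros x u v H. exact (proj1 (proj2_sig (med x u v H)) (Some true)).
  - intros x u v H. exact (proj1 (proj2_sig (med x u v H)) (Some false)).
  - intros x h k E1 E2.
    assert (H : f ∘ (leg K (Some true : cospan_category) ∘ k)
                = p ∘ (leg K (Some false : cospan_category) ∘ k))
      by exact (eq_trans (comp_assoc _ _ _)
           (eq_trans (f_equal (fun z => z ∘ k) comm) (eq_sym (comp_assoc _ _ _)))).
    assert (base' : f ∘ leg K (Some true : cospan_category)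
                    = leg K (None : cospan_category)) by exact (base (Some true)).
    destruct (lim (cospan_cone H)) as [m [_ um]].
    transitivity m; [symmetry |]; apply um; intros [[|]|]; cbn; auto.
    + etransitivity; [| exact (f_equal (comp f) E1)].
      exact (eq_trans (eq_sym (f_equal (fun z => z ∘ h) base'))
               (eq_sym (comp_assoc _ _ _))).
    + exact (eq_trans (eq_sym (f_equal (fun z => z ∘ k) base'))
               (eq_sym (comp_assoc _ _ _))).
Qed.

End Cospan.

Lemma has_finite_limits_pullbacks (C : category) :
  has_finite_limits C -> inhabited (pullback_choice C).
Proof.
  intros lim. constructor. intros a e b f p.
  apply epsilon; [| exact (fun _ => True)].
  destruct (lim _ (cospan f p) cospan_finite) as [K HK].
  exact (cospan_limit_pullback HK).
Qed.

Record point (C : category) (B : C) := Point {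
  pt_ob : C;
  pt_epi : hom pt_ob B;
  pt_sec : hom B pt_ob;
  pt_epi_sec : pt_epi ∘ pt_sec = idm B }.

Record point_hom (C : category) (B : C) (X Y : point B) := PointHom {
  pt_hom : hom (pt_ob X) (pt_ob Y);
  pt_hom_epi : pt_epi Y ∘ pt_hom = pt_epi X;
  pt_hom_sec : pt_hom ∘ pt_sec X = pt_sec Y }.

Lemma point_hom_eq (C : category) (B : C) (X Y : point B) (f g : point_hom X Y) :
  pt_hom f = pt_hom g -> f = g.
Proof.
  destruct f as [f f1 f2], g as [g g1 g2]; cbn; intros <-.
  f_equal; apply proof_irrelevance.
Qed.

Definition point_id (C : category) (B : C) (X : point B) : point_hom X X :=
  @PointHom C B X X (idm (pt_ob X)) (comp_idr _) (comp_idl _).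

Definition point_comp (C : category) (B : C) (X Y Z : point B)
    (g : point_hom Y Z) (f : point_hom X Y) : point_hom X Z.
Proof.
  refine (@PointHom C B X Z (pt_hom g ∘ pt_hom f) _ _).
  - rewrite comp_assoc, pt_hom_epi. apply pt_hom_epi.
  - rewrite <- comp_assoc, pt_hom_sec. apply pt_hom_sec.
Defined.

Definition Pt (C : category) (B : C) : category.
Proof.
  refine (@Category (point B) (@point_hom C B) (@point_id C B)
    (@point_comp C B) _ _ _); intros; apply point_hom_eq.
  - apply comp_idl.
  - apply comp_idr.
  - apply comp_assoc.
Defined.

Section ChangeOfBase.
Variables (C : category) (pb : pullback_choice C) (E B : C) (p : hom E B).

Lemma base_point_comm (X : point B) :
  pt_epi X ∘ (pt_sec X ∘ p) = p ∘ idm E.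
Proof. rewrite comp_assoc, pt_epi_sec, comp_idl, comp_idr. reflexivity. Qed.

Definition base_point (X : point B) : point E :=
  @Point C E (pb_ob (pb (pt_epi X) p)) (pb_snd (pb (pt_epi X) p))
    (pb_pair (pb (pt_epi X) p) (base_point_comm X))
    (pb_snd_pair (pb (pt_epi X) p) (base_point_comm X)).

Lemma base_point_hom_comm (X Y : point B) (f : point_hom X Y) :
  pt_epi Y ∘ (pt_hom f ∘ pb_fst (pb (pt_epi X) p))
  = p ∘ pb_snd (pb (pt_epi X) p).
Proof. rewrite comp_assoc, pt_hom_epi. apply pb_comm. Qed.

Definition base_point_hom (X Y : point B) (f : point_hom X Y) :
  point_hom (base_point X) (base_point Y).
Proof.
  refine (@PointHom C E (base_point X) (base_point Y)
    (pb_pair (pb (pt_epi Y) p) (base_point_hom_comm f)) _ _).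
  - apply pb_snd_pair.
  - apply (@pb_unique _ _ _ _ _ _ (pb (pt_epi Y) p)); cbn.
    + rewrite comp_assoc, !pb_fst_pair, <- comp_assoc, pb_fst_pair, comp_assoc,
        pt_hom_sec. reflexivity.
    + rewrite comp_assoc, !pb_snd_pair. reflexivity.
Defined.

Definition change_of_base : functor (Pt B) (Pt E).
Proof.
  refine (@Functor (Pt B) (Pt E) base_point base_point_hom _ _).
  - intros X. apply point_hom_eq, (@pb_unique _ _ _ _ _ _ (pb (pt_epi X) p)); cbn.
    + rewrite pb_fst_pair, comp_idl, comp_idr. reflexivity.
    + rewrite pb_snd_pair, comp_idr. reflexivity.
  - intros X Y Z g f. apply point_hom_eq, (@pb_unique _ _ _ _ _ _ (pb (pt_epi Z) p)); cbn.
    + rewrite comp_assoc, !pb_fst_pair, <- !comp_assoc, pb_fst_pair. reflexivity.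
    + rewrite comp_assoc, !pb_snd_pair. reflexivity.
Defined.

End ChangeOfBase.

Definition algebraically_coherent (C : category) : Prop :=
  has_finite_limits C /\
  forall (pb : pullback_choice C) (E B : C) (p : hom E B),
    coherent_functor (change_of_base pb p).

Record heyting_semilattice := HeytingSemilattice {
  carrier :> Type;
  top : carrier;
  meet : carrier -> carrier -> carrier;
  imp : carrier -> carrier -> carrier;
  meet_assoc : forall x y z : carrier, meet x (meet y z) = meet (meet x y) z;
  meet_comm : forall x y : carrier, meet x y = meet y x;
  meet_idem : forall x : carrier, meet x x = x;
  meet_top : forall x : carrier, meet x top = x;
  (* [meet x y = x] is the order relation x <= y of the semilattice *)
  meet_imp_adj : forall x y z : carrier,
    meet (meet x y) z = meet x y <-> meet x (imp y z) = x }.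

Arguments top {h}.
Arguments meet {h} x y.
Arguments imp {h} x y.

Definition equationally_linear (H : heyting_semilattice) : Prop :=
  forall x y z : H, meet (imp (imp x y) z) (imp (imp y x) z) = z.

Record heyting_hom (H K : heyting_semilattice) := HeytingHom {
  heyting_fun :> H -> K;
  heyting_fun_top : heyting_fun top = top;
  heyting_fun_meet : forall x y : H,
    heyting_fun (meet x y) = meet (heyting_fun x) (heyting_fun y);
  heyting_fun_imp : forall x y : H,
    heyting_fun (imp x y) = imp (heyting_fun x) (heyting_fun y) }.

Lemma heyting_hom_eq (H K : heyting_semilattice) (f g : heyting_hom H K) :
  (forall x : H, f x = g x) -> f = g.
Proof.
  destruct f as [f f1 f2 f3], g as [g g1 g2 g3]; cbn; intros E.
  apply functional_extensionality in E; subst g.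
  f_equal; apply proof_irrelevance.
Qed.

Definition heyting_id (H : heyting_semilattice) : heyting_hom H H :=
  @HeytingHom H H (fun x => x) eq_refl (fun _ _ => eq_refl) (fun _ _ => eq_refl).

Definition heyting_comp (H K L : heyting_semilattice)
    (g : heyting_hom K L) (f : heyting_hom H K) : heyting_hom H L.
Proof.
  refine (@HeytingHom H L (fun x => g (f x)) _ _ _).
  - rewrite !heyting_fun_top. reflexivity.
  - intros x y. rewrite !heyting_fun_meet. reflexivity.
  - intros x y. rewrite !heyting_fun_imp. reflexivity.
Defined.

Record elhslat := Elhslat {
  elhslat_heyting :> heyting_semilattice;
  elhslat_linear : equationally_linear elhslat_heyting }.

Definition ELHSLat : category.
Proof.
  refine (@Category elhslat (fun H K => heyting_hom H K)
    (fun H => heyting_id H) (fun H K L g f => heyting_comp g f) _ _ _);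
    intros; apply heyting_hom_eq; reflexivity.
Defined.

(* Main.v *)
From Stdlib Require Import List FunctionalExtensionality ProofIrrelevance ClassicalEpsilon.
Require Import Defs.

(** Finite limits are computed on elements: an element of a limit of algebras
    is a compatible family, and an element of a limit of points over [B] is a
    compatible family lying over one element of [B]. Change of base replaces
    the total algebra by pairs agreeing over [B], so it visibly respects such
    families ([change_of_base_limits]).

    For the pairs of morphisms, a pair is jointly strongly epimorphic in the
    category of points exactly when the images of its members together
    generate the common codomain ([jointly_strongly_epi_generated],
    [generated_jointly_strongly_epi]). So let [alpha : Z -> B] be split by
    [beta], and let subalgebras [P] and [Q], both containing the image of
    [beta], generate [Z]. The heart of the proof is [kernel_generated]: the
    kernel of [alpha] is generated by its intersections with [P] and [Q].

    Write [K] for the subalgebra generated by these intersections and [b] for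
    [beta b]. The subalgebra [K] is stable under [b -> _] and under the nucleus
    [nuc b k = (k -> b) -> b]; stability of the latter under implication uses
    linearity, in the form [nuc b (x -> y) = (x -> y) \/ nuc b y]. Linearity
    also gives
      [(d -> b) -> k = (b -> k) /\ ((nuc b d -> k) -> k)],
    easily checked on chains, which rewrites an implication out of [d -> b] in
    terms of those operations. Hence the finite meets of elements of [K] and of
    elements [d -> b] with [d] in [K] form a subalgebra ([normal_subalgebra]).
    It contains [P] and [Q], hence is all of [Z]. When such a meet lies in the
    kernel, each [d -> b] in it is sent to [b], so [b = 1] and that factor is
    [1]: the meet belongs to [K].

    Finally, [z = ((z -> y) -> y) /\ (((z -> y) -> y) -> z)] recovers an element
    from [y = beta (alpha z)] and two kernel elements. In the pullback of
    [alpha] along [p] the kernel is the same, its generators lift to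
    the pullbacks of [P] and [Q], and these contain the section; so they
    generate the pullback ([change_of_base_jointly_strongly_epi]). *)

Set Implicit Arguments.
Unset Strict Implicit.
Unset Printing Implicit Defensive.
Local Open Scope cat_scope.

(** * Forcing in Heyting semilattices *)

Section Order.
Variable H : heyting_semilattice.
Implicit Types x y z c : H.

Definition le x y : Prop := meet x y = x.

Lemma le_refl x : le x x.
Proof. apply meet_idem. Qed.

Lemma le_trans x y z : le x y -> le y z -> le x z.
Proof.
  unfold le; intros Exy Eyz.
  rewrite <- Exy at 1. rewrite <- meet_assoc, Eyz. exact Exy.
Qed.

Lemma le_antisym x y : le x y -> le y x -> x = y.
Proof. unfold le; intros Exy Eyx. rewrite <- Exy, meet_comm. exact Eyx. Qed.

Lemma le_top x : le x top.
Proof. apply meet_top. Qed.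

Lemma meet_le_l x y : le (meet x y) x.
Proof. unfold le. rewrite meet_comm, meet_assoc, meet_idem. reflexivity. Qed.

Lemma meet_le_r x y : le (meet x y) y.
Proof. rewrite meet_comm. apply meet_le_l. Qed.

Lemma le_meet c x y : le c (meet x y) <-> le c x /\ le c y.
Proof.
  split.
  - intros l; split; eapply le_trans;
      [exact l | apply meet_le_l | exact l | apply meet_le_r].
  - unfold le; intros [Ex Ey]. rewrite meet_assoc, Ex. exact Ey.
Qed.

Lemma le_imp c x y :
  le c (imp x y) <-> forall c', le c' c -> le c' x -> le c' y.
Proof.
  split.
  - intros l c' lc lx. apply (le_trans (y := meet c x)).
    + apply le_meet; auto.
    + apply meet_imp_adj. exact l.
  - intros h. apply meet_imp_adj, h; [apply meet_le_l | apply meet_le_r].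
Qed.

Lemma eq_forced x y : (forall c, le c x <-> le c y) -> x = y.
Proof. intros h. apply le_antisym; apply h, le_refl. Qed.

Lemma le_mp c x y : le c (imp x y) -> le c x -> le c y.
Proof. intros l. apply (proj1 (le_imp c x y) l), le_refl. Qed.

End Order.

(** With [le_imp] and [le_meet], [le c x] behaves as a forcing relation, so an
    equation between terms is proved by intuitionistic reasoning about an
    arbitrary stage [c]. [lower] transports every hypothesis of the context to
    a smaller stage, and [assume] introduces the antecedent of an implication. *)
Ltac lower l :=
  repeat match goal with
  | h : le ?c _ |- _ =>
      match type of l with
      | le _ c => lazymatch h with l => fail | _ => apply (le_trans l) in h end
      end
  end; clear l.

Ltac assume c' h :=
  apply le_imp; let l := fresh in intros c' l h; lower l.

Section HeytingIdentities.
Variable H : heyting_semilattice.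
Implicit Types x y z b c d k : H.

Lemma imp_top x : imp x top = top.
Proof.
  apply eq_forced; intros c; split; intros _; [apply le_top|].
  assume c' h. apply le_top.
Qed.

Lemma imp_refl x : imp x x = top.
Proof. apply le_antisym; [apply le_top|]. assume c h. exact h. Qed.

Lemma top_imp x : imp top x = x.
Proof.
  apply eq_forced; intros c; split; intros l.
  - apply (le_mp l), le_top.
  - assume c' h. exact l.
Qed.

Lemma meet_eq_top x y : meet x y = top -> x = top /\ y = top.
Proof.
  intros E; split; (apply le_antisym; [apply le_top | rewrite <- E]);
    [apply meet_le_l | apply meet_le_r].
Qed.

Lemma imp_meet x y z : imp x (meet y z) = meet (imp x y) (imp x z).
Proof.
  apply eq_forced; intros c; rewrite le_meet; split.
  - intros l; split; assume c' h; pose proof (proj1 (le_meet _ _ _) (le_mp l h)); tauto.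
  - intros [l m]. assume c' h. apply le_meet. split; eapply le_mp; eauto.
Qed.

Lemma imp_curry x y z : imp (meet x y) z = imp x (imp y z).
Proof.
  apply eq_forced; intros c; split; intros l.
  - assume c1 h1. assume c2 h2. apply (le_mp l), le_meet; auto.
  - assume c1 h1. apply le_meet in h1 as [h1 h2]. apply (le_mp (le_mp l h1) h2).
Qed.

Lemma imp_swap x y z : imp x (imp y z) = imp y (imp x z).
Proof. rewrite <- !imp_curry, (meet_comm x). reflexivity. Qed.

Lemma imp_imp x y z : imp x (imp y z) = imp (imp x y) (imp x z).
Proof.
  apply eq_forced; intros c; split; intros l.
  - assume c1 h1. assume c2 h2. apply (le_mp (le_mp l h2) (le_mp h1 h2)).
  - assume c1 h1. assume c2 h2. apply (fun m => le_mp (le_mp l m) h1).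
    assume c3 h3. exact h2.
Qed.

Definition nuc b x := imp (imp x b) b.

Lemma nuc_meet b x y : nuc b (meet x y) = meet (nuc b x) (nuc b y).
Proof.
  unfold nuc. apply eq_forced; intros c; rewrite le_meet; split.
  - intros l; split; assume c1 h1; apply (le_mp l); assume c2 h2;
      apply le_meet in h2 as [m1 m2]; eapply le_mp; eauto.
  - intros [l m]. assume c1 h. apply (le_mp l). assume c2 h2. apply (le_mp m). assume c3 h3.
    apply (le_mp h), le_meet; auto.
Qed.

(** This is the identity behind protomodularity: with [y = beta (alpha x)] it
    expresses [x] through [y] and the kernel elements [x -> y] and
    [((x -> y) -> y) -> x]. *)
Lemma reconstruct x y : meet (imp (imp x y) y) (imp (imp (imp x y) y) x) = x.
Proof.
  apply eq_forced; intros c; rewrite le_meet; split.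
  - intros [l m]. exact (le_mp m l).
  - intros l; split; assume c' h.
    + exact (le_mp h l).
    + exact l.
Qed.

End HeytingIdentities.

(** * Consequences of linearity *)

Section LinearIdentities.
Variable H : elhslat.
Implicit Types x y z b c d k : H.

(** Equational linearity as a rule of proof: a goal may be established
    separately under [x -> y] and under [y -> x], as if the algebra were a
    chain. *)
Lemma le_cases x y c z :
  (forall c', le c' c -> le c' (imp x y) -> le c' z) ->
  (forall c', le c' c -> le c' (imp y x) -> le c' z) -> le c z.
Proof.
  intros h1 h2. rewrite <- (elhslat_linear x y z). apply le_meet; split; apply le_imp; assumption.
Qed.

Definition join x y := meet (imp (imp x y) y) (imp (imp y x) x).

(** On a chain with [y < x], the element [x -> y] is [y], and otherwise both
    sides are [1]. Linearity enters through the fact that [join] is below every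
    common upper bound. *)
Lemma nuc_imp b x y : nuc b (imp x y) = join (imp x y) (nuc b y).
Proof.
  unfold nuc, join. apply eq_forced; intros c; rewrite le_meet; split.
  - intros l; split.
    + assume c1 h1. assume c2 h2. apply (le_mp l). assume c3 h3. exact (le_mp (le_mp h1 h3) h2).
    + assume c1 h1. assume c2 h2. apply (fun m => le_mp (le_mp h1 m) h2).
      assume c3 h3. apply (le_mp l). assume c4 h4. exact (le_mp h3 (le_mp h4 h2)).
  - intros [l m]. apply (@le_cases (imp x y) (imp (imp y b) b)); intros c' lc h; lower lc.
    + pose proof (le_mp l h) as n. assume c1 h1. apply (le_mp n). assume c2 h2.
      apply (le_mp h1). assume c3 h3. exact h2.
    + pose proof (le_mp m h) as n. assume c1 h1. exact (le_mp h1 n).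
Qed.

(** On a chain, the left-hand side is [k] when [d <= b] and [b -> k] when
    [b < d]; the element [nuc b d] is [b] in the former case and [1] in the
    latter. The gain is that for [d] and [k] in the kernel of a retraction onto
    a subalgebra containing [b], the elements [b -> k] and [nuc b d] stay in
    that kernel, whereas [d -> b] is sent to [b]. *)
Lemma imp_imp_split b d k :
  imp (imp d b) k = meet (imp b k) (imp (imp (nuc b d) k) k).
Proof.
  unfold nuc. apply eq_forced; intros c; rewrite le_meet; split.
  - intros l; split.
    + assume c1 h1. apply (le_mp l). assume c2 h2. exact h1.
    + assume c1 h1. apply (@le_cases (imp (imp d b) b) (imp d b)); intros c' lc h; lower lc.
      * apply (le_mp l). assume c2 h2. apply (fun m => le_mp (le_mp h m) h2).
        assume c3 h3. exact (le_mp h3 h2).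
      * apply (le_mp h1). assume c2 h2. exact (le_mp (le_mp h h2) h2).
  - intros [l m]. assume c1 h1. apply (le_mp m). assume c2 h2. exact (le_mp l (le_mp h2 h1)).
Qed.

End LinearIdentities.

(** * The kernel of a split epimorphism is generated by its parts *)

Definition subalgebra (H : heyting_semilattice) (S : H -> Prop) : Prop :=
  S top /\ (forall x y, S x -> S y -> S (meet x y)) /\
  (forall x y, S x -> S y -> S (imp x y)).

Inductive generated (H : heyting_semilattice) (P : H -> Prop) : H -> Prop :=
| gen_base x : P x -> generated P x
| gen_top : generated P top
| gen_meet x y : generated P x -> generated P y -> generated P (meet x y)
| gen_imp x y : generated P x -> generated P y -> generated P (imp x y).

Lemma generated_subalgebra (H : heyting_semilattice) (P : H -> Prop) : subalgebra (generated P).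
Proof. repeat split; intros; auto using gen_top, gen_meet, gen_imp. Qed.

Lemma generated_least (H : heyting_semilattice) (P S : H -> Prop) :
  subalgebra S -> (forall x, P x -> S x) -> forall x, generated P x -> S x.
Proof. intros (St & Sm & Si) sub x g. induction g; auto. Qed.

Section SplitExtension.
Variables (Z B : elhslat) (alpha : heyting_hom Z B) (beta : heyting_hom B Z).
Hypothesis alpha_beta : forall b, alpha (beta b) = b.
Variables P Q : Z -> Prop.
Hypotheses (P_sub : subalgebra P) (Q_sub : subalgebra Q).
Hypotheses (P_beta : forall b, P (beta b)) (Q_beta : forall b, Q (beta b)).

Definition kernel_part (k : Z) : Prop := (P k \/ Q k) /\ alpha k = top.

Definition ker_generated (k : Z) : Prop := generated kernel_part k.

Lemma ker_alpha k : ker_generated k -> alpha k = top.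
Proof.
  apply (@generated_least Z kernel_part (fun k => alpha k = top)).
  - repeat split.
    + apply heyting_fun_top.
    + intros x y Ex Ey. rewrite heyting_fun_meet, Ex, Ey. apply meet_idem.
    + intros x y Ex Ey. rewrite heyting_fun_imp, Ex, Ey. apply imp_top.
  - intros x [_ E]. exact E.
Qed.

(** Since [b -> _] distributes over both operations, it suffices to look at
    generators, and there it is an operation of [P] or [Q] because these
    contain [beta b]. *)
Lemma ker_base_imp b k : ker_generated k -> ker_generated (imp (beta b) k).
Proof.
  induction 1 as [k [PQ E] | | x y _ IHx _ IHy | x y _ IHx _ IHy].
  - apply gen_base. split.
    + destruct PQ as [p | q]; [left; apply P_sub | right; apply Q_sub]; auto.
    + rewrite heyting_fun_imp, E. apply imp_top.
  - rewrite imp_top. apply gen_top.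
  - rewrite imp_meet. apply gen_meet; assumption.
  - rewrite imp_imp. apply gen_imp; assumption.
Qed.

(** The induction passes through implications thanks to [nuc_imp], whose
    right-hand side involves the nucleus only at the conclusion [y]. *)
Lemma ker_nuc b k : ker_generated k -> ker_generated (nuc (beta b) k).
Proof.
  induction 1 as [k [PQ E] | | x y gx IHx gy IHy | x y gx IHx gy IHy].
  - apply gen_base. split.
    + destruct PQ as [p | q]; [left | right]; repeat first [apply P_sub | apply Q_sub]; auto.
    + unfold nuc. rewrite !heyting_fun_imp, E, top_imp.
      apply imp_refl.
  - unfold nuc. rewrite top_imp, imp_refl. apply gen_top.
  - rewrite nuc_meet. apply gen_meet; assumption.
  - rewrite nuc_imp. unfold join. repeat first [assumption | apply gen_meet | apply gen_imp].
Qed.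

(** Closure under meets is built in: [imp_curry] and [imp_meet] then reduce an
    implication between normal elements to one between their factors. *)
Inductive normal : Z -> Prop :=
| normal_kernel k : ker_generated k -> normal k
| normal_base d b : ker_generated d -> normal (imp d (beta b))
| normal_meet s t : normal s -> normal t -> normal (meet s t).

Lemma normal_imp_kernel d t : ker_generated d -> normal t -> normal (imp d t).
Proof.
  intros gd. induction 1 as [k gk | e b ge | s t _ IHs _ IHt].
  - apply normal_kernel, gen_imp; assumption.
  - rewrite <- imp_curry. apply normal_base, gen_meet; assumption.
  - rewrite imp_meet. apply normal_meet; assumption.
Qed.

(** [imp_imp_split] settles both kinds of target. For a target
    [e -> beta b'], after exchanging the premises it is applied with
    [k = beta b'], where its second factor becomes
    [nuc b' (nuc b d)], a kernel element. *)
Lemma normal_imp_base d b t : ker_generated d -> normal t -> normal (imp (imp d (beta b)) t).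
Proof.
  intros gd. induction 1 as [k gk | e b' ge | s t _ IHs _ IHt].
  - apply normal_kernel. rewrite imp_imp_split.
    apply gen_meet; [apply ker_base_imp; assumption|].
    apply gen_imp; [apply gen_imp; [apply ker_nuc|]|]; assumption.
  - rewrite imp_swap. apply normal_imp_kernel; [assumption|].
    rewrite imp_imp_split, <- heyting_fun_imp. apply normal_meet.
    + rewrite <- (top_imp (beta _)). apply normal_base, gen_top.
    + apply normal_kernel. exact (ker_nuc _ (ker_nuc _ gd)).
  - rewrite imp_meet. apply normal_meet; assumption.
Qed.

Lemma normal_subalgebra : subalgebra normal.
Proof.
  repeat split.
  - apply normal_kernel, gen_top.
  - apply normal_meet.
  - intros s t ns. revert t.
    induction ns as [k gk | d b gd | s s' _ IHs _ IHs']; intros t nt.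
    + apply normal_imp_kernel; assumption.
    + apply normal_imp_base; assumption.
    + rewrite imp_curry. auto.
Qed.

(** Applying [alpha] to [d -> beta b] gives [b]; so in the kernel [b = 1], and
    the factor itself is [1]. *)
Lemma normal_in_kernel s : normal s -> alpha s = top -> ker_generated s.
Proof.
  induction 1 as [k gk | d b gd | s t _ IHs _ IHt]; intros E.
  - exact gk.
  - rewrite heyting_fun_imp, (ker_alpha gd), top_imp, alpha_beta in E.
    rewrite E, heyting_fun_top, imp_top. apply gen_top.
  - rewrite heyting_fun_meet in E. apply meet_eq_top in E as [Es Et].
    apply gen_meet; [apply IHs | apply IHt]; assumption.
Qed.

Lemma kernel_coords z :
  alpha (imp z (beta (alpha z))) = top /\
  alpha (imp (imp (imp z (beta (alpha z))) (beta (alpha z))) z) = top.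
Proof.
  rewrite !heyting_fun_imp, !alpha_beta, !imp_refl, top_imp, imp_refl. auto.
Qed.

Lemma PQ_normal z : P z \/ Q z -> normal z.
Proof.
  intros PQ. destruct (kernel_coords z) as [E1 E2].
  rewrite <- (reconstruct z (beta (alpha z))).
  apply normal_meet; [apply normal_base | apply normal_kernel]; apply gen_base;
  (split; [|assumption]).
  all: destruct PQ as [p | q]; [left | right]; repeat first [apply P_sub | apply Q_sub]; auto.
Qed.

Hypothesis PQ_generate : forall z, generated (fun z => P z \/ Q z) z.

Lemma kernel_generated k : alpha k = top -> generated kernel_part k.
Proof.
  apply normal_in_kernel.
  exact (generated_least normal_subalgebra PQ_normal (PQ_generate k)).
Qed.

End SplitExtension.

(** * Subalgebras, products and homomorphisms given by their graph *)

Definition sub_heyting (H : heyting_semilattice) (S : H -> Prop) (HS : subalgebra S) :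
  heyting_semilattice.
Proof.
  refine (@HeytingSemilattice {x | S x} (exist S top (proj1 HS))
    (fun x y => exist S (meet (proj1_sig x) (proj1_sig y))
                  (proj1 (proj2 HS) _ _ (proj2_sig x) (proj2_sig y)))
    (fun x y => exist S (imp (proj1_sig x) (proj1_sig y))
                  (proj2 (proj2 HS) _ _ (proj2_sig x) (proj2_sig y))) _ _ _ _ _).
  1-4: intros; apply eq_sig_hprop; [intros; apply proof_irrelevance | cbn].
  - apply meet_assoc.
  - apply meet_comm.
  - apply meet_idem.
  - apply meet_top.
  - intros x y z; split; intros E; apply eq_sig_hprop;
      try (intros; apply proof_irrelevance); cbn;
      apply meet_imp_adj; exact (f_equal (@proj1_sig _ _) E).
Defined.

Definition sub_elhslat (H : elhslat) (S : H -> Prop) (HS : subalgebra S) : elhslat.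
Proof.
  refine (@Elhslat (sub_heyting HS) _).
  intros x y z. apply eq_sig_hprop; [intros; apply proof_irrelevance | apply elhslat_linear].
Defined.

Definition sub_incl (H : elhslat) (S : H -> Prop) (HS : subalgebra S) :
  heyting_hom (sub_elhslat HS) H.
Proof. refine (@HeytingHom (sub_elhslat HS) H (@proj1_sig _ _) _ _ _); reflexivity. Defined.

Definition product_heyting (I : Set) (A : I -> heyting_semilattice) : heyting_semilattice.
Proof.
  refine (@HeytingSemilattice (forall i, A i) (fun _ => top)
    (fun x y i => meet (x i) (y i)) (fun x y i => imp (x i) (y i)) _ _ _ _ _).
  1-4: intros; apply functional_extensionality_dep; intros i.
  - apply meet_assoc.
  - apply meet_comm.
  - apply meet_idem.
  - apply meet_top.
  - intros x y z; split; intros E; apply functional_extensionality_dep; intros i;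
      apply meet_imp_adj; exact (f_equal (fun h => h i) E).
Defined.

Definition product (I : Set) (A : I -> elhslat) : elhslat.
Proof.
  refine (@Elhslat (product_heyting A) _).
  intros x y z. apply functional_extensionality_dep. intros i. apply elhslat_linear.
Defined.

Definition pair_heyting (H K : heyting_semilattice) : heyting_semilattice.
Proof.
  refine (@HeytingSemilattice (H * K) (top, top)
    (fun x y => (meet (fst x) (fst y), meet (snd x) (snd y)))
    (fun x y => (imp (fst x) (fst y), imp (snd x) (snd y))) _ _ _ _ _).
  1-4: intros; repeat match goal with x : (_ * _)%type |- _ => destruct x end; cbn; f_equal.
  1-2: apply meet_assoc.
  1-2: apply meet_comm.
  1-2: apply meet_idem.
  1-2: apply meet_top.
  intros [x x'] [y y'] [z z']; cbn; split; intros E; injection E; intros E' E'';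
    f_equal; apply meet_imp_adj; assumption.
Defined.

Definition pair_elhslat (H K : elhslat) : elhslat.
Proof.
  refine (@Elhslat (pair_heyting H K) _).
  intros [x x'] [y y'] [z z']; cbn; f_equal; apply elhslat_linear.
Defined.

(** Homomorphisms into algebras that are known only through a universal
    property are obtained from their graph. *)
Lemma graph_hom (H K : heyting_semilattice) (R : H -> K -> Prop) :
  (forall x, exists y, R x y) ->
  (forall x y y', R x y -> R x y' -> y = y') ->
  R top top ->
  (forall x y x' y', R x y -> R x' y' -> R (meet x x') (meet y y')) ->
  (forall x y x' y', R x y -> R x' y' -> R (imp x x') (imp y y')) ->
  exists h : heyting_hom H K, forall x, R x (h x).
Proof.
  intros total functional Rt Rm Ri.
  pose (val x := constructive_indefinite_description _ (total x)).
  unshelve eexists (@HeytingHom H K (fun x => proj1_sig (val x)) _ _ _).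
  - eapply functional; [exact (proj2_sig (val top)) | exact Rt].
  - intros x y. eapply functional; [exact (proj2_sig (val _))|].
    apply Rm; apply proj2_sig.
  - intros x y. eapply functional; [exact (proj2_sig (val _))|].
    apply Ri; apply proj2_sig.
  - intros x. exact (proj2_sig (val x)).
Qed.

Lemma hom_eqE (a b : ELHSLat) (f g : hom a b) : f = g -> forall x, f x = g x.
Proof. intros ->. reflexivity. Qed.

(** * Elements of pullbacks and of finite limits *)

Section PullbackElements.
Variables (a e b : ELHSLat) (f : hom a b) (p : hom e b) (pb : pullback f p).

Lemma fiber_subalgebra : @subalgebra (pair_elhslat a e) (fun w => f (fst w) = p (snd w)).
Proof.
  split; [|split].
  - cbn. rewrite !heyting_fun_top. reflexivity.
  - intros x y Ex Ey. cbn. rewrite !heyting_fun_meet, Ex, Ey. reflexivity.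
  - intros x y Ex Ey. cbn. rewrite !heyting_fun_imp, Ex, Ey. reflexivity.
Qed.

Definition fiber : ELHSLat := sub_elhslat fiber_subalgebra.

Definition fiber_fst : hom fiber a.
Proof. refine (@HeytingHom fiber a (fun w => fst (proj1_sig w)) _ _ _); reflexivity. Defined.

Definition fiber_snd : hom fiber e.
Proof. refine (@HeytingHom fiber e (fun w => snd (proj1_sig w)) _ _ _); reflexivity. Defined.

Lemma fiber_comm : f ∘ fiber_fst = p ∘ fiber_snd.
Proof. apply heyting_hom_eq. intros [x Ex]. exact Ex. Qed.

Lemma pb_el_exists (x : a) (y : e) : f x = p y ->
  exists w : pb_ob pb, pb_fst pb w = x /\ pb_snd pb w = y.
Proof.
  intros E. exists (pb_pair pb fiber_comm (exist _ (x, y) E)). split.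
  - exact (hom_eqE (pb_fst_pair pb fiber_comm) (exist _ (x, y) E)).
  - exact (hom_eqE (pb_snd_pair pb fiber_comm) (exist _ (x, y) E)).
Qed.

(** The map to [fiber] taking both components, followed by the universal map
    back, is the identity of the pullback; so an element is recovered from its
    components. *)
Lemma pb_el_eq (w w' : pb_ob pb) :
  pb_fst pb w = pb_fst pb w' -> pb_snd pb w = pb_snd pb w' -> w = w'.
Proof.
  intros E1 E2.
  destruct (@graph_hom (pb_ob pb) fiber (fun v u => proj1_sig u = (pb_fst pb v, pb_snd pb v)))
    as [h Eh].
  - intros v. exists (exist _ (pb_fst pb v, pb_snd pb v) (hom_eqE (pb_comm pb) v)). reflexivity.
  - intros v y y' Ey Ey'. apply eq_sig_hprop; [intros; apply proof_irrelevance | congruence].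
  - cbn. rewrite !heyting_fun_top. reflexivity.
  - intros v y v' y' Ey Ey'. rewrite !heyting_fun_meet.
    exact (f_equal2 (@meet (pair_elhslat a e)) Ey Ey').
  - intros v y v' y' Ey Ey'. rewrite !heyting_fun_imp.
    exact (f_equal2 (@imp (pair_elhslat a e)) Ey Ey').
  - assert (id_h : pb_pair pb fiber_comm ∘ (h : hom (pb_ob pb) fiber) = idm _).
    { apply (@pb_unique _ _ _ _ _ _ pb); rewrite comp_assoc, comp_idr, ?pb_fst_pair, ?pb_snd_pair;
        apply heyting_hom_eq; intros v; cbn; rewrite Eh; reflexivity. }
    assert (Ehw : h w = h w').
    { apply eq_sig_hprop; [intros; apply proof_irrelevance | rewrite !Eh; congruence]. }
    transitivity (pb_pair pb fiber_comm (h w)); [exact (eq_sym (hom_eqE id_h w))|].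
    rewrite Ehw. exact (hom_eqE id_h w').
Qed.

End PullbackElements.

(** The product of a family indexed by the objects of [J] lives in the universe
    of those objects, which is too large for a carrier. A finite [J] is
    therefore indexed by a small set, not necessarily injectively. *)
Lemma finite_small_index (T : Type) : finite_type T ->
  exists (I : Set) (e : I -> T), forall x, exists i, e i = x.
Proof.
  intros [s Hs].
  assert (G : exists (I : Set) (e : I -> T), forall x, In x s -> exists i, e i = x).
  { clear Hs. induction s as [|t s (I & e & IH)].
    - exists Empty_set, (fun i : Empty_set => match i with end). intros x [].
    - exists (option I), (fun o => match o with Some i => e i | None => t end).
      intros x [E | ins].
      + exists None. exact E.
      + destruct (IH x ins) as [i E]. exists (Some i). exact E. }
  destruct G as (I & e & G). exists I, e. auto.
Qed.

Definition compatible (J : category) (D : functor J ELHSLat) (a : forall j, D j) : Prop :=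
  forall (i j : J) (u : hom i j), fhom D u (a i) = a j.

Definition elementwise_limit (J : category) (D : functor J ELHSLat) (K : cone D) : Prop :=
  (forall x y : apex K, (forall j, leg K j x = leg K j y) -> x = y) /\
  (forall a : forall j, D j, compatible a -> exists x : apex K, forall j, leg K j x = a j).

Lemma elementwise_limit_is_limit (J : category) (D : functor J ELHSLat) (K : cone D) :
  elementwise_limit K -> is_limit K.
Proof.
  intros [inj real] K'.
  destruct (@graph_hom (apex K') (apex K) (fun x y => forall j, leg K j y = leg K' j x))
    as [h Eh].
  - intros x. apply (real (fun j => leg K' j x)).
    intros i j u. exact (hom_eqE (leg_natural K' u) x).
  - intros x y y' Ey Ey'. apply inj. congruence.
  - intros j. rewrite !heyting_fun_top. reflexivity.
  - intros x y x' y' Ey Ey' j. rewrite !heyting_fun_meet, Ey, Ey'. reflexivity.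
  - intros x y x' y' Ey Ey' j. rewrite !heyting_fun_imp, Ey, Ey'. reflexivity.
  - exists (h : hom (apex K') (apex K)). split.
    + intros j. apply heyting_hom_eq. intros x. apply Eh.
    + intros h' Eh'. apply heyting_hom_eq. intros x. apply inj. intros j.
      rewrite Eh. exact (eq_sym (hom_eqE (Eh' j) x)).
Qed.

(** The limit consists of the families indexed by [I] that are compatible along
    every morphism; identity morphisms make the components at two indices of
    the same object agree, so the choice of an index for each object in [lg]
    does not matter. *)
Lemma elementwise_limit_exists (J : category) (D : functor J ELHSLat) :
  finite_category J -> exists K : cone D, elementwise_limit K.
Proof.
  intros [fin _]. destruct (finite_small_index fin) as (I & e & surj).
  pose (A := product (fun i => (D (e i) : elhslat))).
  pose (S := fun a : A => forall (i i' : I) (u : hom (e i) (e i')), fhom D u (a i) = a i').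
  assert (HS : subalgebra S).
  { split; [|split]; unfold S; cbn.
    - intros. apply heyting_fun_top.
    - intros x y Ex Ey i i' u. rewrite heyting_fun_meet, Ex, Ey. reflexivity.
    - intros x y Ex Ey i i' u. rewrite heyting_fun_imp, Ex, Ey. reflexivity. }
  pose (L := sub_elhslat HS : ELHSLat).
  pose (pr := fun i => @HeytingHom L (D (e i) : elhslat) (fun w => proj1_sig w i)
    eq_refl (fun _ _ => eq_refl) (fun _ _ => eq_refl)).
  pose (idx := fun j => constructive_indefinite_description _ (surj j)).
  pose (lg := fun j : J => match proj2_sig (idx j) in _ = j' return hom L (D j') with
    eq_refl => pr (proj1_sig (idx j)) end).
  assert (lg_nat : forall (i : I) (j : J) (u : hom (e i) j), fhom D u ∘ (pr i : hom L _) = lg j).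
  { intros i j. unfold lg. destruct (proj2_sig (idx j)). intros u.
    apply heyting_hom_eq. intros [w Ew]. apply Ew. }
  assert (lg_pr : forall i, lg (e i) = pr i).
  { intros i. rewrite <- (lg_nat i _ (idm _)), fhom_id, comp_idl. reflexivity. }
  unshelve eexists (@Cone J ELHSLat D L lg _); [|split].
  - intros i j u. destruct (surj i) as [i' <-]. rewrite lg_pr. apply lg_nat.
  - cbn. intros x y E. apply eq_sig_hprop; [intros; apply proof_irrelevance|].
    apply functional_extensionality_dep. intros i.
    specialize (E (e i)). rewrite lg_pr in E. exact E.
  - intros a Ha. exists (exist S (fun i => a (e i)) (fun i i' u => Ha _ _ u)).
    intros j. destruct (surj j) as [i <-]. cbn. rewrite lg_pr. reflexivity.
Qed.

Lemma elhslat_finite_limits : has_finite_limits ELHSLat.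
Proof.
  intros J D fin. destruct (elementwise_limit_exists D fin) as [K HK].
  exists K. apply elementwise_limit_is_limit. exact HK.
Qed.

(** * Change of base preserves finite limits *)

Definition forget_point (B : ELHSLat) : functor (Pt B) ELHSLat :=
  @Functor (Pt B) ELHSLat (fun X => pt_ob X) (fun X Y f => pt_hom f)
    (fun _ => eq_refl) (fun _ _ _ _ _ => eq_refl).

Lemma pt_epi_hom_el (C : ELHSLat) (X Y : point C) (f : point_hom X Y) x :
  pt_epi Y (pt_hom f x) = pt_epi X x.
Proof. exact (hom_eqE (pt_hom_epi f) x). Qed.

Lemma pt_hom_sec_el (C : ELHSLat) (X Y : point C) (f : point_hom X Y) b :
  pt_hom f (pt_sec X b) = pt_sec Y b.
Proof. exact (hom_eqE (pt_hom_sec f) b). Qed.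

Lemma pt_epi_sec_el (C : ELHSLat) (X : point C) b : pt_epi X (pt_sec X b) = b.
Proof. exact (hom_eqE (pt_epi_sec X) b). Qed.

Section PointLimits.
Variables (J : category) (B : ELHSLat) (D : functor J (Pt B)).
Hypothesis fin : finite_category J.

Definition point_elementwise_limit (K : cone D) : Prop :=
  (forall x y : pt_ob (apex K), pt_epi (apex K) x = pt_epi (apex K) y ->
    (forall j, pt_hom (leg K j) x = pt_hom (leg K j) y) -> x = y) /\
  (forall (b : B) (a : forall j, pt_ob (D j)),
    @compatible J (functor_comp (forget_point B) D) a ->
    (forall j, pt_epi (D j) (a j) = b) ->
    exists x : pt_ob (apex K), pt_epi (apex K) x = b /\ forall j, pt_hom (leg K j) x = a j).

(** The points over [B] whose elements are the families described by
    [point_elementwise_limit] form a cone [KL]. Existence of elements of [K] is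
    read off the map from [KL] to [K]; uniqueness from the map back,
    because [K] is a retract of [KL] by its universal property. *)
Lemma point_limit_elementwise (K : cone D) : is_limit K -> point_elementwise_limit K.
Proof.
  intros lim.
  destruct (elementwise_limit_exists (functor_comp (forget_point B) D) fin) as (L0 & inj & real).
  cbn in inj, real.
  pose (S := fun w : pair_elhslat B (apex L0) =>
    forall j, pt_epi (D j) ((leg L0 j : hom _ (pt_ob (D j))) (snd w)) = fst w).
  assert (HS : subalgebra S).
  { split; [|split]; unfold S; cbn.
    - intros j. rewrite !heyting_fun_top. reflexivity.
    - intros x y Ex Ey j. rewrite !heyting_fun_meet, Ex, Ey. reflexivity.
    - intros x y Ex Ey j. rewrite !heyting_fun_imp, Ex, Ey. reflexivity. }
  pose (L := sub_elhslat HS : ELHSLat).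
  pose (epi := @HeytingHom L (B : elhslat) (fun w => fst (proj1_sig w))
    eq_refl (fun _ _ => eq_refl) (fun _ _ => eq_refl) : hom L B).
  pose (lg := fun j => (leg L0 j : hom _ (pt_ob (D j))) ∘
    (@HeytingHom L (apex L0 : elhslat) (fun w => snd (proj1_sig w))
      eq_refl (fun _ _ => eq_refl) (fun _ _ => eq_refl) : hom L (apex L0))).
  assert (L_eq : forall w w' : L, epi w = epi w' -> (forall j, lg j w = lg j w') -> w = w').
  { intros [[b l] Hl] [[b' l'] Hl'] E1 E2. cbn in E1, E2.
    apply eq_sig_hprop; [intros; apply proof_irrelevance|]. cbn. f_equal; auto. }
  assert (L_real : forall (b : B) (a : forall j, pt_ob (D j)),
    @compatible J (functor_comp (forget_point B) D) a -> (forall j, pt_epi (D j) (a j) = b) ->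
    exists w : L, epi w = b /\ forall j, lg j w = a j).
  { intros b a Ha Hb. destruct (real a Ha) as [l El].
    assert (Sl : S (b, l)). { intros j. cbn. rewrite El. apply Hb. }
    exists (exist S (b, l) Sl). split; [reflexivity | exact El]. }
  destruct (@graph_hom B L (fun b w => epi w = b /\ forall j, lg j w = pt_sec (D j) b))
    as [sec Hsec].
  { intros b. apply L_real.
    - intros i j u. exact (hom_eqE (pt_hom_sec (fhom D u)) b).
    - intros j. exact (hom_eqE (pt_epi_sec (D j)) b). }
  { intros b w w' [E1 E2] [E1' E2']. apply L_eq; congruence. }
  { split; intros; rewrite !heyting_fun_top; reflexivity. }
  { intros b w b' w' [E1 E2] [E1' E2']. split; intros; rewrite !heyting_fun_meet; congruence. }
  { intros b w b' w' [E1 E2] [E1' E2']. split; intros; rewrite !heyting_fun_imp; congruence. }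
  assert (epi_sec : epi ∘ (sec : hom B L) = idm B).
  { apply heyting_hom_eq. intros b. apply Hsec. }
  pose (PL := @Point ELHSLat B L epi sec epi_sec : Pt B).
  assert (lg_epi : forall j, pt_epi (D j) ∘ lg j = epi).
  { intros j. apply heyting_hom_eq. intros [w Hw]. apply Hw. }
  assert (lg_sec : forall j, lg j ∘ (sec : hom B L) = pt_sec (D j)).
  { intros j. apply heyting_hom_eq. intros b. apply Hsec. }
  pose (plg := fun j => @PointHom ELHSLat B PL (D j) (lg j) (lg_epi j) (lg_sec j) : hom PL (D j)).
  assert (plg_nat : forall i j (u : hom i j), fhom D u ∘ plg i = plg j).
  { intros i j u. apply point_hom_eq, heyting_hom_eq. intros w.
    exact (hom_eqE (leg_natural L0 u) _). }
  pose (KL := @Cone J (Pt B) D PL plg plg_nat).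
  destruct (lim KL) as [h [Eh _]].
  assert (h_epi : forall w : L, pt_epi (apex K) (pt_hom h w) = epi w)
    by exact (hom_eqE (pt_hom_epi h)).
  assert (h_leg : forall j (w : L), pt_hom (leg K j) (pt_hom h w) = lg j w)
    by exact (fun j => hom_eqE (f_equal (@pt_hom _ _ _ _) (Eh j))).
  split.
  - destruct (@graph_hom (pt_ob (apex K)) L (fun x w => epi w = pt_epi (apex K) x /\
      forall j, lg j w = pt_hom (leg K j) x)) as [k Hk].
    { intros x. apply L_real.
      - intros i j u. exact (hom_eqE (f_equal (@pt_hom _ _ _ _) (leg_natural K u)) x).
      - intros j. exact (hom_eqE (pt_hom_epi (leg K j)) x). }
    { intros b w w' [E1 E2] [E1' E2']. apply L_eq; congruence. }
    { split; intros; rewrite !heyting_fun_top; reflexivity. }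
    { intros b w b' w' [E1 E2] [E1' E2']. split; intros; rewrite !heyting_fun_meet; congruence. }
    { intros b w b' w' [E1 E2] [E1' E2']. split; intros; rewrite !heyting_fun_imp; congruence. }
    assert (k_epi : pt_epi PL ∘ (k : hom (pt_ob (apex K)) L) = pt_epi (apex K)).
    { apply heyting_hom_eq. intros x. apply Hk. }
    assert (k_sec : (k : hom (pt_ob (apex K)) L) ∘ pt_sec (apex K) = pt_sec PL).
    { apply heyting_hom_eq. intros b.
      destruct (Hk (pt_sec (apex K) b)) as [E1 E2], (Hsec b) as [E1' E2']. apply L_eq.
      - exact (eq_trans E1 (eq_trans (hom_eqE (pt_epi_sec (apex K)) b) (eq_sym E1'))).
      - intros j.
        exact (eq_trans (E2 j) (eq_trans (hom_eqE (pt_hom_sec (leg K j)) b) (eq_sym (E2' j)))). }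
    pose (pk := @PointHom ELHSLat B (apex K) PL k k_epi k_sec : hom (apex K) PL).
    assert (hk : h ∘ pk = idm (apex K)).
    { destruct (lim K) as [m [_ um]]. rewrite <- (um (idm _)); [symmetry; apply um|].
      - intros j. rewrite comp_assoc, Eh. apply point_hom_eq, heyting_hom_eq. intros x. apply Hk.
      - intros j. apply comp_idr. }
    assert (hk_el : forall x, pt_hom h (k x) = x)
      by exact (hom_eqE (f_equal (@pt_hom _ _ _ _) hk)).
    intros x y Exy Elg. rewrite <- (hk_el x), <- (hk_el y). f_equal.
    apply L_eq.
    + rewrite (proj1 (Hk x)), (proj1 (Hk y)). exact Exy.
    + intros j. rewrite (proj2 (Hk x)), (proj2 (Hk y)). apply Elg.
  - intros b a Ha Hb. destruct (L_real b a Ha Hb) as [w [E1 E2]].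
    exists (pt_hom h w). rewrite h_epi. split; [exact E1|].
    intros j. rewrite h_leg. apply E2.
Qed.

End PointLimits.

Section ChangeOfBaseElements.
Variables (pb : pullback_choice ELHSLat) (E B : ELHSLat) (p : hom E B).

Definition base_fst (X : point B) : hom (pt_ob (base_point pb p X)) (pt_ob X) :=
  pb_fst (pb (pt_epi X) p).

Lemma base_exists (X : point B) (x : pt_ob X) (e : E) : pt_epi X x = p e ->
  exists w, base_fst X w = x /\ pt_epi (base_point pb p X) w = e.
Proof. apply pb_el_exists. Qed.

Lemma base_eq (X : point B) (w w' : pt_ob (base_point pb p X)) :
  base_fst X w = base_fst X w' ->
  pt_epi (base_point pb p X) w = pt_epi (base_point pb p X) w' -> w = w'.
Proof. apply pb_el_eq. Qed.

Lemma base_comm (X : point B) w : pt_epi X (base_fst X w) = p (pt_epi (base_point pb p X) w).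
Proof. exact (hom_eqE (pb_comm (pb (pt_epi X) p)) w). Qed.

Lemma base_fst_sec (X : point B) (e : E) :
  base_fst X (pt_sec (base_point pb p X) e) = pt_sec X (p e).
Proof. exact (hom_eqE (pb_fst_pair (pb (pt_epi X) p) (base_point_comm p X)) e). Qed.

Lemma base_fst_hom (X Y : point B) (f : point_hom X Y) w :
  base_fst Y (pt_hom (base_point_hom pb p f) w) = pt_hom f (base_fst X w).
Proof. exact (hom_eqE (pb_fst_pair (pb (pt_epi Y) p) (base_point_hom_comm pb p f)) w). Qed.

(** An element of the pullback of [apex K] is determined by its component over
    [E] and the legs of its first component, since its image in [B] is
    prescribed by the component over [E]. *)
Lemma change_of_base_limits : preserves_finite_limits (change_of_base pb p).
Proof.
  intros J D K fin lim K'.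
  destruct (point_limit_elementwise fin lim) as [inj real].
  pose (legK' := fun j => leg K' j : point_hom (apex K') (base_point pb p (D j))).
  pose (R := fun (x : pt_ob (apex K')) (w : pt_ob (base_point pb p (apex K))) =>
    pt_epi (base_point pb p (apex K)) w = pt_epi (apex K') x /\
    forall j, pt_hom (leg K j) (base_fst (apex K) w) = base_fst (D j) (pt_hom (legK' j) x)).
  assert (functional : forall x w w', R x w -> R x w' -> w = w').
  { intros x w w' [E1 E2] [E1' E2']. apply base_eq; [|congruence].
    apply inj; [|congruence]. rewrite !base_comm. congruence. }
  assert (ex_h : exists h : heyting_hom (pt_ob (apex K')) (pt_ob (base_point pb p (apex K))),
    forall x, R x (h x)).
  { apply graph_hom.
    - intros x.
      destruct (real (p (pt_epi (apex K') x)) (fun j => base_fst (D j) (pt_hom (legK' j) x)))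
        as [y [E1 E2]].
      + intros i j u. cbn.
        rewrite <- base_fst_hom. f_equal.
        exact (hom_eqE (f_equal (@pt_hom _ _ _ _) (leg_natural K' u)) x).
      + intros j. rewrite base_comm, pt_epi_hom_el. reflexivity.
      + destruct (base_exists E1) as [w [F1 F2]]. exists w. split; [exact F2|].
        intros j. rewrite F1. apply E2.
    - exact functional.
    - split; intros; rewrite !heyting_fun_top; reflexivity.
    - intros x w x' w' [E1 E2] [E1' E2']. split; intros; rewrite !heyting_fun_meet; congruence.
    - intros x w x' w' [E1 E2] [E1' E2']. split; intros; rewrite !heyting_fun_imp; congruence. }
  destruct ex_h as [h Hh].
  pose (h' := h : hom (pt_ob (apex K')) (pt_ob (base_point pb p (apex K)))).
  assert (h_epi : pt_epi (base_point pb p (apex K)) ∘ h' = pt_epi (apex K')).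
  { apply heyting_hom_eq. intros x. apply Hh. }
  assert (h_sec : h' ∘ pt_sec (apex K') = pt_sec (base_point pb p (apex K))).
  { apply heyting_hom_eq. intros e. refine (functional _ _ _ (Hh _) _). split.
    - rewrite !pt_epi_sec_el. reflexivity.
    - intros j. rewrite pt_hom_sec_el, !base_fst_sec. apply pt_hom_sec_el. }
  exists (@PointHom ELHSLat E (apex K') (base_point pb p (apex K)) h h_epi h_sec). split.
  - intros j. apply point_hom_eq, heyting_hom_eq. intros x.
    apply (@base_eq (D j)).
    + refine (eq_trans (base_fst_hom _ _) _). apply Hh.
    + refine (eq_trans (pt_epi_hom_el _ _) _).
      symmetry. apply (pt_epi_hom_el (legK' j)).
  - intros k Ek. apply point_hom_eq, heyting_hom_eq. intros x.
    refine (functional _ _ _ (Hh x) _). split.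
    + apply (pt_epi_hom_el k).
    + intros j. rewrite <- base_fst_hom. f_equal.
      exact (hom_eqE (f_equal (@pt_hom _ _ _ _) (Ek j)) x).
Qed.

End ChangeOfBaseElements.

(** * Jointly strongly epimorphic pairs of points *)

Section JointlyStronglyEpi.
Variable B : ELHSLat.

Definition image (a b : ELHSLat) (f : hom a b) (y : b) : Prop := exists x, f x = y.

Lemma image_subalgebra (a b : ELHSLat) (f : hom a b) : subalgebra (image f).
Proof.
  split; [|split].
  - exists top. apply heyting_fun_top.
  - intros _ _ [x <-] [y <-]. exists (meet x y). apply heyting_fun_meet.
  - intros _ _ [x <-] [y <-]. exists (imp x y). apply heyting_fun_imp.
Qed.

(** The kernel pair of [m] is a point over [B] whose section is the diagonal of
    the section of [X], and [m] identifies its two projections. *)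
Lemma point_mono_injective (X Y : Pt B) (m : hom X Y) : is_mono m ->
  forall x x' : pt_ob X, pt_hom m x = pt_hom m x' -> x = x'.
Proof.
  intros mono x x' Ex.
  pose (S := fun w : pair_elhslat (pt_ob X) (pt_ob X) => pt_hom m (fst w) = pt_hom m (snd w)).
  assert (HS : subalgebra S).
  { split; [|split]; unfold S; cbn.
    - rewrite !heyting_fun_top. reflexivity.
    - intros u v Eu Ev. rewrite !heyting_fun_meet, Eu, Ev. reflexivity.
    - intros u v Eu Ev. rewrite !heyting_fun_imp, Eu, Ev. reflexivity. }
  pose (R := sub_elhslat HS : ELHSLat).
  pose (p1 := @HeytingHom R (pt_ob X : elhslat) (fun w => fst (proj1_sig w))
    eq_refl (fun _ _ => eq_refl) (fun _ _ => eq_refl) : hom R (pt_ob X)).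
  pose (p2 := @HeytingHom R (pt_ob X : elhslat) (fun w => snd (proj1_sig w))
    eq_refl (fun _ _ => eq_refl) (fun _ _ => eq_refl) : hom R (pt_ob X)).
  assert (diag : exists d : heyting_hom B R,
    forall b, proj1_sig (d b) = (pt_sec X b, pt_sec X b)).
  { apply (@graph_hom B R (fun b w => proj1_sig w = (pt_sec X b, pt_sec X b))).
    - intros b. exists (exist S (pt_sec X b, pt_sec X b) eq_refl). reflexivity.
    - intros b w w' Ew Ew'. apply eq_sig_hprop; [intros; apply proof_irrelevance | congruence].
    - rewrite !heyting_fun_top. reflexivity.
    - intros b w b' w' Ew Ew'. rewrite !heyting_fun_meet.
      exact (f_equal2 (@meet (pair_elhslat (pt_ob X) (pt_ob X))) Ew Ew').
    - intros b w b' w' Ew Ew'. rewrite !heyting_fun_imp.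
      exact (f_equal2 (@imp (pair_elhslat (pt_ob X) (pt_ob X))) Ew Ew'). }
  destruct diag as [d Hd].
  assert (p1_d : p1 ∘ (d : hom B R) = pt_sec X).
  { apply heyting_hom_eq. intros b. exact (f_equal fst (Hd b)). }
  assert (p2_d : p2 ∘ (d : hom B R) = pt_sec X).
  { apply heyting_hom_eq. intros b. exact (f_equal snd (Hd b)). }
  assert (p2_epi : pt_epi X ∘ p2 = pt_epi X ∘ p1).
  { apply heyting_hom_eq. intros [w Hw]. cbn.
    rewrite <- !(pt_epi_hom_el m). f_equal. symmetry. exact Hw. }
  assert (epi_d : (pt_epi X ∘ p1) ∘ (d : hom B R) = idm B).
  { rewrite <- comp_assoc, p1_d. apply pt_epi_sec. }
  pose (PR := @Point ELHSLat B R (pt_epi X ∘ p1) d epi_d : Pt B).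
  pose (q1 := @PointHom ELHSLat B PR X p1 eq_refl p1_d : hom PR X).
  pose (q2 := @PointHom ELHSLat B PR X p2 p2_epi p2_d : hom PR X).
  assert (E : q1 = q2).
  { apply mono, point_hom_eq, heyting_hom_eq. intros [w Hw]. exact Hw. }
  exact (hom_eqE (f_equal (@pt_hom _ _ _ _) E) (exist S (x, x') Ex)).
Qed.

Variables (X Y Z : Pt B) (f : hom X Z) (g : hom Y Z).

(** The generated subalgebra contains the section, since [f] preserves it, so
    its inclusion is a monomorphism of points through which [f] and [g]
    factor. *)
Lemma jointly_strongly_epi_generated : jointly_strongly_epi f g ->
  forall z, generated (fun z => image (pt_hom f) z \/ image (pt_hom g) z) z.
Proof.
  intros jse.
  set (G := generated _).
  pose (S := sub_elhslat (generated_subalgebra _ : subalgebra G) : ELHSLat).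
  pose (i := sub_incl (generated_subalgebra _ : subalgebra G) : hom S (pt_ob Z)).
  assert (factor : forall (A : ELHSLat) (h : hom A (pt_ob Z)), (forall x, G (h x)) ->
    exists h' : hom A S, i ∘ h' = h).
  { intros A h Gh. destruct (@graph_hom A S (fun x w => i w = h x)) as [h' Hh'].
    - intros x. exists (exist G (h x) (Gh x)). reflexivity.
    - intros x w w' Ew Ew'. apply eq_sig_hprop; [intros; apply proof_irrelevance|].
      exact (eq_trans Ew (eq_sym Ew')).
    - rewrite !heyting_fun_top. reflexivity.
    - intros x w x' w' Ew Ew'. rewrite !heyting_fun_meet. congruence.
    - intros x w x' w' Ew Ew'. rewrite !heyting_fun_imp. congruence.
    - exists h'. apply heyting_hom_eq. exact Hh'. }
  assert (i_inj : forall w w' : S, i w = i w' -> w = w').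
  { intros w w' Ew. apply eq_sig_hprop; [intros; apply proof_irrelevance | exact Ew]. }
  destruct (factor B (pt_sec Z)) as [s Hs].
  { intros b. apply gen_base. left. exists (pt_sec X b). apply pt_hom_sec_el. }
  assert (epi_s : (pt_epi Z ∘ i) ∘ s = idm B) by (rewrite <- comp_assoc, Hs; apply pt_epi_sec).
  pose (PS := @Point ELHSLat B S (pt_epi Z ∘ i) s epi_s : Pt B).
  pose (m := @PointHom ELHSLat B PS Z i eq_refl Hs : hom PS Z).
  assert (mono : is_mono m).
  { intros W u v Euv. apply point_hom_eq, heyting_hom_eq. intros w. apply i_inj.
    exact (hom_eqE (f_equal (@pt_hom _ _ _ _) Euv) w). }
  assert (factors : forall (W : Pt B) (h : hom W Z),
    (forall x, G (pt_hom h x)) -> factors_through h m).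
  { intros W h Gh. destruct (factor _ (pt_hom h) Gh) as [h' Hh'].
    unshelve eexists (@PointHom ELHSLat B W PS h' _ _).
    - change ((pt_epi Z ∘ i) ∘ h' = pt_epi W). rewrite <- comp_assoc, Hh'. apply pt_hom_epi.
    - apply heyting_hom_eq. intros b. apply i_inj.
      refine (eq_trans (hom_eqE Hh' _) (eq_trans _ (eq_sym (hom_eqE Hs b)))).
      apply pt_hom_sec_el.
    - apply point_hom_eq. exact Hh'. }
  destruct (jse PS m mono) as [n [_ mn]].
  - apply factors. intros x. apply gen_base. left. exists x. reflexivity.
  - apply factors. intros x. apply gen_base. right. exists x. reflexivity.
  - intros z.
    pose proof (hom_eqE (f_equal (@pt_hom _ _ _ _) mn) z : proj1_sig (pt_hom n z) = z) as Ez.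
    rewrite <- Ez. exact (proj2_sig (pt_hom n z)).
Qed.

(** A monomorphism of points through which both factor is injective, and its
    image is a subalgebra containing the generators; a bijective morphism is
    invertible. *)
Lemma generated_jointly_strongly_epi :
  (forall z, generated (fun z => image (pt_hom f) z \/ image (pt_hom g) z) z) ->
  jointly_strongly_epi f g.
Proof.
  intros gen W m mono [f' Ef] [g' Eg].
  pose proof (point_mono_injective mono) as inj.
  assert (surj : forall z, exists w, pt_hom m w = z).
  { intros z. refine (generated_least (image_subalgebra (pt_hom m)) _ (gen z)).
    intros _ [[x <-] | [x <-]].
    - exists (pt_hom f' x). exact (hom_eqE (f_equal (@pt_hom _ _ _ _) Ef) x).
    - exists (pt_hom g' x). exact (hom_eqE (f_equal (@pt_hom _ _ _ _) Eg) x). }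
  destruct (@graph_hom (pt_ob Z) (pt_ob W) (fun z w => pt_hom m w = z)) as [n Hn].
  - exact surj.
  - intros z w w' Ew Ew'. apply inj. congruence.
  - apply heyting_fun_top.
  - intros z w z' w' Ew Ew'. rewrite !heyting_fun_meet. congruence.
  - intros z w z' w' Ew Ew'. rewrite !heyting_fun_imp. congruence.
  - unshelve eexists (@PointHom ELHSLat B Z W n _ _).
    + apply heyting_hom_eq. intros z.
      exact (eq_trans (eq_sym (pt_epi_hom_el m _)) (f_equal (pt_epi Z) (Hn z))).
    + apply heyting_hom_eq. intros b. apply inj.
      exact (eq_trans (Hn _) (eq_sym (pt_hom_sec_el m b))).
    + split; apply point_hom_eq, heyting_hom_eq; intros z.
      * apply inj. exact (Hn _).
      * exact (Hn z).
Qed.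

End JointlyStronglyEpi.

(** The subalgebra [W] of the pullback generated by the two images contains
    every element whose first component lies in an image of [f] or [g]. Over
    the top element of [E] it therefore contains lifts of the generators given
    by [kernel_generated], hence the whole kernel; it also contains the section,
    and [reconstruct] builds every element from these. *)
Lemma change_of_base_jointly_strongly_epi (pb : pullback_choice ELHSLat) (E B : ELHSLat)
    (p : hom E B) :
  preserves_jointly_strongly_epi (change_of_base pb p).
Proof.
  intros X Y Z f g jse.
  pose proof (jointly_strongly_epi_generated jse) as gen.
  apply generated_jointly_strongly_epi.
  pose (f' := base_point_hom pb p f). pose (g' := base_point_hom pb p g).
  set (T := base_point pb p Z).
  change (forall w : pt_ob T, generated (fun w => image (pt_hom f') w \/ image (pt_hom g') w) w).
  set (W := generated (fun w : pt_ob T => image (pt_hom f') w \/ image (pt_hom g') w)).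
  assert (fiber_image : forall w : pt_ob T,
    image (pt_hom f) (base_fst pb p Z w) \/ image (pt_hom g) (base_fst pb p Z w) -> W w).
  { intros w H. apply gen_base. destruct H as [[x Ex] | [x Ex]]; [left | right].
    all: destruct (@base_exists pb E B p _ x (pt_epi T w)) as [v [E1 E2]];
      [rewrite <- (base_comm w : _ = p (pt_epi T w)), <- Ex; symmetry; apply pt_epi_hom_el|].
    all: exists v; apply base_eq; [rewrite <- Ex, <- E1; apply base_fst_hom
       | exact (eq_trans (pt_epi_hom_el _ _) E2)]. }
  assert (kernel : forall k, pt_epi Z k = top ->
    forall w, base_fst pb p Z w = k -> pt_epi T w = top -> W w).
  { intros k Hk.
    pose proof (@kernel_generated (pt_ob Z) B (pt_epi Z) (pt_sec Z) (pt_epi_sec_el Z) _ _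
      (image_subalgebra (pt_hom f)) (image_subalgebra (pt_hom g))
      (fun b => ex_intro _ _ (pt_hom_sec_el f b)) (fun b => ex_intro _ _ (pt_hom_sec_el g b))
      gen k Hk) as gen_k.
    assert (lift : exists w, W w /\ base_fst pb p Z w = k /\ pt_epi T w = top).
    { clear Hk. induction gen_k as [k [PQ Ek] | | x y _ (u & Wu & Eu & Fu) _ (v & Wv & Ev & Fv)
        | x y _ (u & Wu & Eu & Fu) _ (v & Wv & Ev & Fv)].
      - destruct (@base_exists pb E B p Z k top) as [w [E1 E2]].
        { rewrite heyting_fun_top. exact Ek. }
        exists w. split; [|split]; trivial. apply fiber_image. rewrite E1. exact PQ.
      - exists top. split; [apply gen_top|]. rewrite !heyting_fun_top. auto.
      - exists (meet u v). split; [apply gen_meet; assumption|].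
        split; (etransitivity; [apply heyting_fun_meet|]); [exact (f_equal2 meet Eu Ev)|].
        etransitivity; [exact (f_equal2 meet Fu Fv) | apply meet_idem].
      - exists (imp u v). split; [apply gen_imp; assumption|].
        split; (etransitivity; [apply heyting_fun_imp|]); [exact (f_equal2 imp Eu Ev)|].
        etransitivity; [exact (f_equal2 imp Fu Fv) | apply imp_top]. }
    intros w E1 E2. destruct lift as (v & Wv & E1' & E2').
    replace w with v; [exact Wv|]. apply base_eq; [congruence|].
    exact (eq_trans E2' (eq_sym E2)). }
  assert (sections : forall e : E, W (pt_sec T e)).
  { intros e. apply gen_base. left. exists (pt_sec (base_point pb p X) e). apply pt_hom_sec_el. }
  intros w. change (W w).
  pose (t := pt_sec T (pt_epi T w)).
  rewrite <- (reconstruct w t).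
  destruct (kernel_coords (pt_epi_sec_el T) w) as [E1 E2]. fold t in E1, E2.
  assert (in_kernel : forall v, pt_epi T v = top -> W v).
  { intros v Ev. apply (kernel (base_fst pb p Z v)); trivial.
    rewrite base_comm. fold T. rewrite Ev. apply heyting_fun_top. }
  apply gen_meet; [apply gen_imp; [|apply sections]|]; apply in_kernel; assumption.
Qed.

Theorem theorem4p14 : algebraically_coherent ELHSLat.
Proof.
  split.
  - exact elhslat_finite_limits.
  - intros pb E B p. split.
    + apply change_of_base_limits.
    + apply change_of_base_jointly_strongly_epi.
Qed.
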